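(* Let $N$ be a positive integer and let $f$ be a cwN-hyperbolic homeomorphism of a compact metric space $X$. Then for each positive integer $k$ the map $f$ has only finitely many periodic points with period $k$. In particular, $f$ has only finitely many fixed points.
   Context: Let $f$ be a homeomorphism of a compact metric space $(X,d)$. For $c>0$ and $x\in X$ put $W^s_c(x)=\{y\in X: d(f^n(x),f^n(y))\le c \text{ for all } n\ge 0\}$ and $W^u_c(x)=\{y\in X: d(f^{-n}(x),f^{-n}(y))\le c \text{ for all } n\ge 0\}$. Let $C^s_c(x)$ (resp. $C^u_c(x)$) be the connected component of $W^s_c(x)$ (resp. $W^u_c(x)$) containing $x$. $f$ is cw-expansive if there is $c>0$ such that $W^u_c(x)\cap W^s_c(x)$ is totally disconnected for every $x\in X$. $f$ satisfies the cw-local-product-structure if for each $\varepsilon>0$ there is $\delta>0$ such that $C^s_\varepsilon(x)\cap C^u_\varepsilon(y)\ne\emptyset$ whenever $d(x,y)<\delta$. $f$ is cw-hyperbolic if it is cw-expansive and satisfies the cw-local-product-structure; by convention, saying that $f$ is cw-hyperbolic includes that $X$ is a Peano continuum (compact, connected, locally connected metric space). A cw-expansive homeomorphism $f$ is cwN-expansive if there is $c>0$ such that $\#(C^s_c(x)\cap C^u_c(x))\le N$ for every $x\in X$; $f$ is cwN-hyperbolic if it is cw-hyperbolic and cwN-expansive. *)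

(* Defs.v *)
From mathcomp Require Import all_boot all_order all_algebra.
From mathcomp Require Import all_classical all_reals all_analysis.

Set Implicit Arguments.
Unset Strict Implicit.
Unset Printing Implicit Defensive.

Import Order.TTheory GRing.Theory Num.Theory.

Local Open Scope classical_set_scope.
Local Open Scope ring_scope.

(* The inverse is carried as data because its iterates enter the definition of
   the unstable sets; it is determined by the underlying function. *)
Record homeo (X : topologicalType) := Homeo {
  homeo_fun :> X -> X;
  homeo_inv : X -> X;
  homeo_funK : cancel homeo_fun homeo_inv;
  homeo_invK : cancel homeo_inv homeo_fun;
  homeo_fun_continuous : continuous homeo_fun;
  homeo_inv_continuous : continuous homeo_inv }.

Definition locally_connected (X : topologicalType) :=
  forall (x : X) (U : set X), nbhs x U ->
    exists V : set X, [/\ open V, V x, connected V & V `<=` U].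

Section CwDynamics.
Context {R : realType} {X : metricType R}.
Implicit Types (f : homeo X) (c : R) (x : X) (N k : nat).

Definition stable_set f c x : set X :=
  [set y | forall n : nat, mdist (iter n f x) (iter n f y) <= c].

Definition unstable_set f c x : set X :=
  [set y | forall n : nat,
     mdist (iter n (homeo_inv f) x) (iter n (homeo_inv f) y) <= c].

Definition stable_component f c x : set X :=
  connected_component (stable_set f c x) x.

Definition unstable_component f c x : set X :=
  connected_component (unstable_set f c x) x.

Definition cw_expansive f :=
  exists2 c : R, 0 < c &
    forall x, totally_disconnected (unstable_set f c x `&` stable_set f c x).

Definition cw_local_product_structure f :=
  forall eps : R, 0 < eps -> exists2 delta : R, 0 < delta &
    forall x y : X, mdist x y < delta ->
      stable_component f eps x `&` unstable_component f eps y !=set0.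

Definition cwN_expansive N f :=
  cw_expansive f /\
  exists2 c : R, 0 < c &
    forall x, (stable_component f c x `&` unstable_component f c x #<= `I_N)%card.

Definition periodic_points f k : set X := [set x | iter k f x = x].

End CwDynamics.

Definition peano_continuum {R : realType} (X : metricType R) :=
  [/\ compact [set: X], connected [set: X] & locally_connected X].

(* By convention, cw-hyperbolicity of f includes that the space is a Peano
   continuum. *)
Definition cw_hyperbolic {R : realType} {X : metricType R} (f : homeo X) :=
  [/\ peano_continuum X, cw_expansive f & cw_local_product_structure f].

Definition cwN_hyperbolic {R : realType} {X : metricType R} (N : nat)
  (f : homeo X) := cw_hyperbolic f /\ cwN_expansive N f.

(* Main.v *)
Require Import Defs.
From mathcomp Require Import all_boot all_order all_algebra.
From mathcomp Require Import all_classical all_reals all_analysis.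

(** Two distinct points [p], [q] of period [k] cannot be too close, so that by
compactness there are finitely many of them.

If [p] and [q] are close, the local product structure gives a point [z] common
to a small stable component of [p] and a small unstable component of [q].  Since
[p] and [q] are fixed by the [k]-th iterate, pulling back by [f^(-kj)] keeps [z]
in the unstable component of [q], and, for [j <= N], enlarges the stable
component of [p] only by the modulus of continuity of finitely many iterates of
the inverse.  Starting from a small enough scale, the [N + 1] points
[f^(-kj) z] therefore all lie in one intersection of a stable and an unstable
component of the size at which such intersections have at most [N] points.  Two
of them coincide, which makes [z] periodic.

A periodic point [z] in the stable component [C] of a periodic point [p] must be
[p] ([periodic_stable_component]).  Indeed, if [f^m] fixes both, the images
[f^(nm) C] decrease to a connected set ([bigcap_connected]) that contains [p]
and [z] and stays close to [p] in the past as well as in the future; by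
cw-expansiveness this set is a point.  The same result for the inverse
of [f] gives [z = q], hence [p = q]. *)

Set Implicit Arguments.
Unset Strict Implicit.
Unset Printing Implicit Defensive.

Import Order.TTheory GRing.Theory Num.Theory.

Local Open Scope classical_set_scope.
Local Open Scope ring_scope.

(** * Iterates, and connected images *)

Lemma iter_fixed (T : Type) (g : T -> T) (x : T) (m n : nat) :
  iter m g x = x -> iter (n * m) g x = x.
Proof. by move=> gx; elim: n => // n IH; rewrite mulSn iterD IH. Qed.

Lemma iter_cancel (T : Type) (g h : T -> T) (n : nat) :
  cancel g h -> cancel (iter n g) (iter n h).
Proof. by move=> gK; elim: n => // n IH x; rewrite iterSr iterS gK IH. Qed.

Lemma iter_continuous (T : topologicalType) (g : T -> T) (n : nat) :
  continuous g -> continuous (iter n g).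
Proof.
move=> cg; elim: n => [x|n IH x]; first exact: cvg_id.
by apply: (@continuous_comp _ _ _ (iter n g) g); [exact: IH|exact: cg].
Qed.

Lemma connected_image (T U : topologicalType) (g : T -> U) (A : set T) :
  continuous g -> connected A -> connected (g @` A).
Proof.
move=> cg cA; apply: connected_continuous_connected cA _.
exact: continuous_subspaceT.
Qed.

(** * Compact metric spaces *)

Section CompactMetric.
Context {R : realType} {X : metricType R}.
Hypothesis cptX : compact [set: X].

(** A separation of the intersection extends, by normality, to disjoint open
sets [U] and [V]; by compactness [U `|` V] already contains some [K n], whose
connectedness puts it inside one of the two. *)
Lemma bigcap_connected (K : nat -> set X) :
  (forall n, closed (K n)) -> (forall n, connected (K n)) ->
  (forall n, K n.+1 `<=` K n) -> connected (\bigcap_n K n).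
Proof.
move=> clK cK decK.
have homoK m n : (m <= n)%N -> K n `<=` K m.
  by move/subnKC <-; elim: (n - m)%N => [|i IH]; rewrite ?addn0// addnS => y /decK/IH.
apply/connectedP => E [E0 EU sE].
have clA : closed (\bigcap_n K n) by apply: closed_bigI => n _; exact: clK.
have clE b : closed (E b).
  move=> y cy.
  have : (\bigcap_n K n) y.
    apply: clA; apply: closureS cy; rewrite EU.
    by case: b => ? ?; [right|left].
  rewrite EU; case: sE => s1 s2; case: b cy => cy [] // Ey.
    by have : set0 y by rewrite -s2.
  by have : set0 y by rewrite -s1.
have [U [V [oU oV EU' EV UV]]] := (@normal_openP R X).1
  (compact_normal (@metric_hausdorff R X) cptX)
  _ _ (clE false) (clE true) (separated_disjoint sE).
(* A point outside the intersection avoids some [K m], hence, with a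
   neighbourhood, all later [K n]. *)
have : \forall n \near \oo, [set: X] `<=` (fun x => K n x -> (U `|` V) x).
  apply: (compact_near_coveringP _).1 cptX _ _ (fun n x => K n x -> (U `|` V) x) _ _.
  move=> x _; have [Ax|Ax] := pselect ((\bigcap_n K n) x).
    exists (U `|` V, setT); last by move=> [y n] [].
    split; last exact: filterT.
    apply: open_nbhs_nbhs; split; first exact: openU.
    by move: Ax; rewrite EU => -[/EU'|/EV]; [left|right].
  have [m Km] : exists m, ~ K m x.
    by apply: contrapT => /forallNP h; apply: Ax => m _; apply: contrapT (h m).
  exists (~` K m, [set n | (m <= n)%N]).
    split; last by exists m.
    by apply: open_nbhs_nbhs; split => //; exact: closed_openC.
  by move=> [y n] /= [Kmy mn] /(homoK _ _ mn).
move=> [n _ /(_ n (leqnn n)) KUV].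
have sUV : separated U V.
  have sep (A B : set X) : open B -> A `&` B = set0 -> closure A `&` B = set0.
    move=> oB AB; rewrite -subset0 => y [/(_ B (open_nbhs_nbhs (conj oB _)))].
    by move=> + By => /(_ By) [w]; rewrite AB.
  by split; [|rewrite setIC]; apply: sep => //; rewrite setIC.
have [] := connected_subset sUV (fun y Ky => KUV y I Ky) (cK n).
- have [y Ey] := E0 true => KU.
  have : (U `&` V) y; last by rewrite UV.
  split; last exact: EV.
  have : (\bigcap_n K n) y by rewrite EU; right.
  by move=> /(_ n I)/KU.
- have [y Ey] := E0 false => KV.
  have : (U `&` V) y; last by rewrite UV.
  split; first exact: EU'.
  have : (\bigcap_n K n) y by rewrite EU; left.
  by move=> /(_ n I)/KV.
Qed.

Lemma closed_mdist_le (a : X) (c : R) : closed [set y | mdist a y <= c].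
Proof.
move=> y cy /=; apply/ler_addgt0Pr => e e0.
have [z [/= az]] := cy _ (nbhsx_ballx y e e0); rewrite ballEmdist/= => yz.
apply: le_trans (metric_triangle a z y) _.
by rewrite lerD// metric_sym ltW.
Qed.

Lemma compact_unif_continuous (g : X -> X) (eps : R) : continuous g -> 0 < eps ->
  exists2 eta : R, 0 < eta &
    forall x y, mdist x y <= eta -> mdist (g x) (g y) <= eps.
Proof.
move=> cg eps0.
have e20 : 0 < eps / 2 by rewrite divr_gt0.
have : \forall e \near (0 : R)^'+,
    [set: X] `<=` (fun x => forall y, mdist x y <= e -> mdist (g x) (g y) <= eps).
  apply: (compact_near_coveringP _).1 cptX _ _
    (fun e x => forall y, mdist x y <= e -> mdist (g x) (g y) <= eps) _ _.
  move=> x _.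
  have /nbhs_ballP[r /= r0 xr] := cg x _ (nbhsx_ballx (g x) _ e20).
  have r20 : 0 < r / 2 by rewrite divr_gt0.
  exists (ball x (r / 2), [set e | e < r / 2]).
    split; first exact: nbhsx_ballx.
    exact: nbhs_right_lt.
  move=> [x' e] /= [xx' er] y x'y.
  have gxx' : ball (g x) (eps / 2) (g x').
    by apply: xr; apply: le_ball xx'; rewrite ler_pdivrMr// ler_peMr ?ler1n// ltW.
  have gxy : ball (g x) (eps / 2) (g y).
    apply: xr; rewrite [r]splitr; apply: ball_triangle xx' _.
    by rewrite ballEmdist/=; exact: le_lt_trans x'y er.
  have := ball_triangle (ball_sym gxx') gxy.
  by rewrite -splitr ballEmdist/= => /ltW.
move=> h; have [e [e0 he]] : exists e : R, 0 < e /\ [set: X] `<=`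
    (fun x => forall y, mdist x y <= e -> mdist (g x) (g y) <= eps).
  near (0 : R)^'+ => e; exists e; split; near: e => //.
  exact: nbhs_right_gt.
by exists e => // x y; exact: he.
Unshelve. all: by end_near. Qed.

Lemma iter_unif_continuous (g : X -> X) (eps : R) (M : nat) :
  continuous g -> 0 < eps ->
  exists2 eta : R, 0 < eta & forall x y, mdist x y <= eta ->
    forall i, (i <= M)%N -> mdist (iter i g x) (iter i g y) <= eps.
Proof.
move=> cg eps0; elim: M => [|M [eta eta0 IH]].
  by exists eps => // x y xy i; rewrite leqn0 => /eqP ->.
have [eta' eta'0 geta] := compact_unif_continuous cg eta0.
exists (Num.min eps eta'); first by rewrite lt_min eps0.
move=> x y; rewrite le_min => /andP[xe xe'] [//|i] iM.
by rewrite !iterSr; apply: IH => //; exact: geta.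
Qed.

(** An injective sequence in [A] would have a cluster point, around which two of
its terms would be less than [delta] apart. *)
Lemma finite_separated (A : set X) (delta : R) : 0 < delta ->
  (forall x y, A x -> A y -> mdist x y < delta -> x = y) -> finite_set A.
Proof.
move=> d0 sepA; have d20 : 0 < delta / 2 by rewrite divr_gt0.
apply: contrapT => /infiniteP/card_leP[u].
pose v n : X := val (u (to_setT n)).
have Av n : A (v n) by exact: set_valP.
have vinj : injective v.
  move=> m n /val_inj /inj; rewrite !in_setT => /(_ isT isT).
  by move/(congr1 val).
have [x [_ xcl]] := @cptX (v @ \oo) _ filterT.
have near_x m : exists2 n, (m <= n)%N & mdist x (v n) < delta / 2.
  have := xcl [set v n | n in [set n | (m <= n)%N]] (ball x (delta / 2)).
  case; first by exists m => // n mn; exists n.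
    exact: nbhsx_ballx.
  by move=> _ [[n mn <-] xn]; exists n => //; rewrite ballEmdist in xn.
have [m _ xm] := near_x 0%N; have [n mn xn] := near_x m.+1.
have /vinj mn' : v m = v n.
  apply: sepA => //; apply: le_lt_trans (metric_triangle _ x _) _.
  by rewrite [ltRHS]splitr ltrD// metric_sym.
by rewrite mn' ltnn in mn.
Qed.

(** * Stable components *)

(** Unstable sets and components of [f] are, by conversion, the stable ones of
[homeo_inverse f]; each lemma below on stable components thus also serves for
unstable ones. *)
Definition homeo_inverse (f : homeo X) : homeo X :=
  Homeo (homeo_invK f) (homeo_funK f) (@homeo_inv_continuous _ f)
    (@homeo_fun_continuous _ f).

Implicit Types (f : homeo X) (c : R) (x y z p q : X).

Lemma stable_set_closed f c x : closed (stable_set f c x).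
Proof.
rewrite (_ : stable_set f c x =
  \bigcap_n (iter n f @^-1` [set y | mdist (iter n f x) y <= c])); last first.
  by apply/seteqP; split => y h n; [move=> _|]; exact: h.
apply: closed_bigI => n _; apply: preimage_closed; last exact: closed_mdist_le.
by move=> y _; apply: iter_continuous; exact: homeo_fun_continuous.
Qed.

Lemma stable_component_iter f c x y n : stable_component f c x y ->
  stable_component f c (iter n f x) (iter n f y).
Proof.
move=> [B [Bx Bs Bc By]].
exists (iter n f @` B); last by exists y.
split; first by exists x.
- by move=> _ [b Bb <-] j; rewrite -!iterD; exact: Bs.
- apply: connected_image => //; apply: iter_continuous.
  exact: homeo_fun_continuous.
Qed.

(** Pulling a stable component back by [i] steps only adds to the future orbits
the first [i] terms, and these are controlled by the uniform continuity of the
iterates of the inverse. *)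
Lemma stable_component_pullback f eps eps1 x y M :
  (forall a b, mdist a b <= eps1 -> forall i, (i <= M)%N ->
     mdist (iter i (homeo_inv f) a) (iter i (homeo_inv f) b) <= eps) ->
  stable_component f eps1 x y -> forall i, (i <= M)%N ->
  stable_component f eps (iter i (homeo_inv f) x) (iter i (homeo_inv f) y).
Proof.
move=> unif [B [Bx Bs Bc By]] i iM.
exists (iter i (homeo_inv f) @` B); last by exists y.
split; first by exists x.
- move=> _ [b Bb <-] j; have [ij|ji] := leqP i j.
    rewrite -(subnK ij) !iterD !(iter_cancel _ (homeo_invK f)).
    by apply: (unif _ _ _ 0%N) => //; exact: Bs.
  rewrite -(subnKC (ltnW ji)) !iterD !(iter_cancel _ (homeo_invK f)).
  apply: unif; first exact: (Bs _ Bb 0%N).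
  by rewrite (leq_trans (leq_subr _ _)).
- apply: connected_image => //; apply: iter_continuous.
  exact: homeo_inv_continuous.
Qed.

Lemma stable_component_le f c c' x :
  c <= c' -> stable_component f c x `<=` stable_component f c' x.
Proof.
move=> cc' y [B [Bx Bs Bc By]]; exists B => //; split => // b Bb n.
exact: le_trans (Bs b Bb n) cc'.
Qed.

(** Allows the bound on the intersection of the two components of a single point
to be used for the stable component of one point and the unstable component of
another, by recentering both at a common point. *)
Lemma stable_component_recenter f c x z :
  stable_component f c x z ->
  stable_component f c x `<=` stable_component f (c + c) z.
Proof.
move=> xz y xy; exists (stable_component f c x) => //; split => //.
- move=> b /connected_component_sub xb n.
  apply: le_trans (metric_triangle _ (iter n f x) _) _.
  by rewrite lerD// metric_sym; exact: (connected_component_sub xz).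
- exact: component_connected.
Qed.

(** The stable component [C] of [p] satisfies [f^m C `<=` C], so the sets
[f^(nm) C] decrease.  Their intersection is a connected set through [p] and [z]
whose points have, arbitrarily far in the past, a preimage in [C]; hence their
whole orbits stay [c]-close to that of [p], and total disconnectedness
identifies [z] with [p]. *)
Lemma periodic_stable_component f c p z m : (0 < m)%N ->
  totally_disconnected (unstable_set f c p `&` stable_set f c p) ->
  iter m f p = p -> iter m f z = z -> stable_component f c p z -> z = p.
Proof.
move=> m0 tdp fp fz pz.
have cf n : continuous (iter n f).
  by apply: iter_continuous; exact: homeo_fun_continuous.
pose C := stable_component f c p.
pose K n := iter (n * m) f @` C.
have Cp : C p by case: pz => B [Bp Bs Bc _]; exists B.
have clC : closed C by apply: component_closed; exact: stable_set_closed.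
have fC : iter m f @` C `<=` C.
  by move=> _ [y Cy <-]; rewrite /C -{1}fp; exact: stable_component_iter.
have decK n : K n.+1 `<=` K n.
  move=> _ [y Cy <-]; rewrite mulSn addnC iterD.
  by exists (iter m f y) => //; apply: fC; exists y.
have KC n : K n `<=` C.
  by elim: n => [y [w Cw <-//]|n IH y /decK/IH].
have clK n : closed (K n).
  apply: compact_closed; first exact: metric_hausdorff.
  apply: continuous_compact; first exact: continuous_subspaceT.
  exact: subclosed_compact clC cptX _.
have cK : connected (\bigcap_n K n).
  apply: bigcap_connected => //.
  by move=> n; apply: connected_image => //; exact: component_connected.
have Kfix y : iter m f y = y -> C y -> (\bigcap_n K n) y.
  by move=> fy Cy n _; exists y => //; exact: iter_fixed.
have Kp := Kfix p fp Cp; have Kz := Kfix z fz pz.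
have KW : \bigcap_n K n `<=` unstable_set f c p `&` stable_set f c p.
  move=> y Ky; split; last exact: connected_component_sub (KC 0%N _ (Ky 0%N I)).
  (* As [0 < m], a preimage of order [i * m] lies at least [i] steps back. *)
  move=> i; have [w Cw <-] := Ky i I.
  have im : (i <= i * m)%N by rewrite leq_pmulr.
  rewrite -{1}(iter_fixed i fp) -(subnKC im) !iterD.
  rewrite !(iter_cancel _ (homeo_funK f)).
  exact: (connected_component_sub Cw).
have := connected_component_max Kp KW cK Kz.
by rewrite tdp//; exact: KW.
Qed.

End CompactMetric.

(** * Finiteness of the set of periodic points *)

Theorem theorem4p2 (R : realType) (X : metricType R) (f : homeo X) (N : nat)
  (cptX : compact [set: X]) (N_gt0 : (0 < N)%N) (hf : cwN_hyperbolic N f) :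
  (forall k : nat, (0 < k)%N -> finite_set (periodic_points f k)) /\
  finite_set [set x : X | f x = x].
Proof.
suff main k : (0 < k)%N -> finite_set (periodic_points f k).
  by split=> //; exact: (main 1%N).
move=> k0.
have [[_ [c1 c10 td] lps] [_ [c2 c20 cardN]]] := hf.
(* [eps] is doubled when the components are recentered at [z]. *)
have [eps [eps0 epsc1 epsc2]] : exists eps : R,
    [/\ 0 < eps, eps <= c1 & eps + eps <= c2].
  exists (Num.min c1 (c2 / 2)); split.
  - by rewrite lt_min c10 divr_gt0.
  - by rewrite ge_min lexx.
  - by rewrite [leRHS]splitr lerD// ge_min lexx orbT.
have [eta eta0 unif] := iter_unif_continuous cptX (N * k)
  (@homeo_inv_continuous _ f) eps0.
have [e1 [e10 e1eps e1eta]] : exists e1 : R, [/\ 0 < e1, e1 <= eps & e1 <= eta].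
  by exists (Num.min eps eta); split; rewrite ?lt_min ?ge_min ?eps0 ?eta0 ?lexx ?orbT.
have [delta delta0 lpsd] := lps e1 e10.
apply: (finite_separated cptX delta0) => p q fp fq pq.
have [z [pz qz]] := lpsd p q pq.
pose g := homeo_inverse f.
have gp : iter k g p = p by rewrite -{1}fp (iter_cancel _ (homeo_funK f)).
have gq : iter k g q = q by rewrite -{1}fq (iter_cancel _ (homeo_funK f)).
have e1c1 : e1 <= c1 := le_trans e1eps epsc1.
(* Either two of the points [f^(-kj) z], [j <= N], coincide, and then [z] is
   periodic, or there are too many of them. *)
have [/existsP[i /existsP[j /andP[ij /eqP zij]]]|inj] := boolP
    [exists i : 'I_N.+1, exists j : 'I_N.+1,
      (i < j)%N && (iter (i * k) g z == iter (j * k) g z)].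
  pose m := ((j - i) * k)%N.
  have m0 : (0 < m)%N by rewrite muln_gt0 subn_gt0 ij.
  have gz : iter m g z = z.
    apply: (can_inj (iter_cancel (i * k) (homeo_invK f))).
    by rewrite -iterD -mulnDl (subnKC (ltnW ij)) zij.
  have fz : iter m f z = z by rewrite -{1}gz (iter_cancel _ (homeo_invK f)).
  have <- : z = p.
    apply: (periodic_stable_component cptX m0 (td p)) => //.
      exact: iter_fixed.
    exact: stable_component_le pz.
  apply: (@periodic_stable_component _ _ cptX g c1 q z m m0) => //.
  - by rewrite setIC; exact: td.
  - exact: iter_fixed.
  - exact: (@stable_component_le _ _ g _ _ _ e1c1).
exfalso.
have pzj j : (j <= N)%N -> stable_component f eps p (iter (j * k) g z).
  move=> jN; rewrite -(iter_fixed j gp).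
  apply: (@stable_component_pullback _ _ f eps e1 _ _ (N * k)) => //.
    by move=> a b ab; apply: unif; exact: le_trans ab e1eta.
  by rewrite leq_mul2r jN orbT.
have qzj j : stable_component g eps q (iter (j * k) g z).
  rewrite -(iter_fixed j gq); apply: stable_component_iter.
  exact: (@stable_component_le _ _ g _ _ _ e1eps).
have sub : (fun j => iter (j * k) g z) @` `I_N.+1 `<=`
    stable_component f c2 z `&` unstable_component f c2 z.
  move=> _ [j /= jN <-]; split.
    apply: (stable_component_le epsc2).
    exact: (stable_component_recenter (pzj 0%N _)) (pzj _ jN).
  apply: (@stable_component_le _ _ g _ _ _ epsc2).
  exact: (@stable_component_recenter _ _ g _ _ _ (qzj 0%N)) (qzj j).
have := card_le_trans (subset_card_le sub) (cardN z).
rewrite (card_le_eql (inj_card_eq _)) ?card_le_II ?ltnn//.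
move=> i j /set_mem/= iN /set_mem/= jN zij.
move/existsPn : inj => inj.
wlog ij : i j iN jN zij / (i < j)%N.
  by move=> wl; have [|/esym|//] := ltngtP i j => h; [exact: wl|apply/esym/wl].
have := inj (Ordinal iN) => /existsPn/(_ (Ordinal jN)) /=.
by rewrite ij zij eqxx.
Qed.
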